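(* Let $X$ be a finite metric space with $n=\#X$ points, let $\sigma(X)=(\sigma_1,\ldots,\sigma_{n-1})$ be its $\operatorname{mst}$-spectrum, and suppose that $\operatorname{diam}X\le 1/2$. Then for every $k$ with $1\le k\le n-1$, $$ \sigma_k=1-2\,d_{GH}(X,\Delta_{k+1}). $$
   Context: For a metric space, $|xy|$ denotes the distance between points $x$ and $y$, and $\#X$ is the cardinality of $X$. $d_{GH}$ denotes the Gromov--Hausdorff distance: $d_{GH}(X,Y)$ is the infimum of real numbers $r$ such that there exist a metric space $Z$ and subsets $X',Y'\subset Z$ isometric to $X$ and $Y$ respectively with Hausdorff distance $d_H(X',Y')\le r$. $\Delta_m$ denotes the metric space on $\{1,\ldots,m\}$ all of whose nonzero distances equal $1$. Minimum spanning trees: for a finite metric space $X$, consider trees $G=(X,E)$ with vertex set exactly $X$; the length of an edge $e=vw$ is $|e|=|vw|$ and the length $|G|$ of $G$ is the sum of the lengths of its edges. A minimum spanning tree on $X$ is such a tree of the smallest possible length. $\operatorname{mst}$-spectrum: for a minimum spanning tree $G$ on $X$, let $\sigma(G)$ be the vector of the lengths of the edges of $G$, ordered descending (with multiplicity), so it has $\#X-1$ entries. This vector does not depend on the choice of the minimum spanning tree $G$, and it is called the $\operatorname{mst}$-spectrum $\sigma(X)=(\sigma_1,\ldots,\sigma_{n-1})$, $\sigma_1\ge\cdots\ge\sigma_{n-1}$, of $X$. *)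

(* Defs.v *)
From HB Require Import structures.
From mathcomp Require Import all_boot all_order all_algebra.
From mathcomp Require Import all_classical all_reals all_analysis.

Set Implicit Arguments.
Unset Strict Implicit.
Unset Printing Implicit Defensive.

Import Order.TTheory GRing.Theory Num.Theory.

Local Open Scope classical_set_scope.
Local Open Scope ring_scope.

#[short(type="finMetricType")]
HB.structure Definition FinMetric (K : numDomainType) :=
  { M of Metric K M & Finite M }.

Section GromovHausdorff.
Context {R : realType}.

(* Distances between sets and spaces are extended reals, so that they are +oo
   (and not a default real value) when there is no admissible radius. *)
Definition hausdorff_dist (Z : metricType R) (A B : set Z) : \bar R :=
  ereal_inf [set r%:E | r in [set r : R | [/\ 0 < r,
    A `<=` \bigcup_(b in B) ball b r & B `<=` \bigcup_(a in A) ball a r]]].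

Definition isometric_to (X Z : metricType R) (A : set Z) : Prop :=
  exists2 f : X -> Z,
    forall x y : X, mdist (f x) (f y) = mdist x y & range f = A.

Definition gromov_hausdorff_dist (X Y : metricType R) : \bar R :=
  ereal_inf [set r%:E | r in [set r : R |
    exists (Z : metricType R) (X' Y' : set Z),
      [/\ isometric_to X X', isometric_to Y Y' &
          (hausdorff_dist X' Y' <= r%:E)%E]]].

Definition diam (X : metricType R) : \bar R :=
  ereal_sup (range (fun p : X * X => (mdist p.1 p.2)%:E)).

End GromovHausdorff.

Definition simplex (R : realType) (m : nat) : Type := 'I_m.

Section Simplex.
Variables (R : realType) (m : nat).

HB.instance Definition _ := Finite.on (simplex R m).

Definition simplex_dist (i j : simplex R m) : R := (i != j)%:R.

Lemma simplex_distxx i : simplex_dist i i = 0.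
Proof. by rewrite /simplex_dist eqxx. Qed.

Lemma simplex_dist_positivity i j : simplex_dist i j = 0 -> i = j.
Proof.
by rewrite /simplex_dist; case: eqVneq => //= _ /eqP; rewrite oner_eq0.
Qed.

Lemma simplex_dist_sym i j : simplex_dist i j = simplex_dist j i.
Proof. by rewrite /simplex_dist eq_sym. Qed.

Lemma simplex_dist_triangle j i l :
  simplex_dist i l <= simplex_dist i j + simplex_dist j l.
Proof.
rewrite /simplex_dist -natrD ler_nat.
by have [->|] := eqVneq i j; [case: (j != l)|case: (i != l)].
Qed.

HB.instance Definition _ := isMetric.Build R (simplex R m)
  simplex_distxx simplex_dist_positivity simplex_dist_sym simplex_dist_triangle.

End Simplex.

Section MinimumSpanningTrees.
Context {R : realType}.
Variable X : finMetricType R.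
Implicit Types (E F : {set {set X}}) (e : {set X}).

(* A graph on the vertex set X is given by its set of edges, each edge being
   the two-element set of its ends. *)
Definition adjacent E : rel X := [rel x y | (x != y) && ([set x; y]%SET \in E)].

(* The bound 2 discards the closed walk x, y, x along a single edge. *)
Definition is_tree E : Prop :=
  [/\ forall e, e \in E -> #|e| = 2,
      forall x y, connect (adjacent E) x y &
      forall c, ucycle (adjacent E) c -> (size c <= 2)%N].

Definition edge_length e : R :=
  if [pick p : X * X | e == [set p.1; p.2]%SET] is Some p
  then mdist p.1 p.2 else 0.

Lemma edge_length2 (x y : X) : edge_length [set x; y]%SET = mdist x y.
Proof.
rewrite /edge_length; case: pickP => [[v w] /= /eqP eqxy|/(_ (x, y))]; last first.
  by rewrite eqxx.
have xvw : x \in [set v; w]%SET by rewrite -eqxy set21.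
have yvw : y \in [set v; w]%SET by rewrite -eqxy set22.
have vxy : v \in [set x; y]%SET by rewrite eqxy set21.
have wxy : w \in [set x; y]%SET by rewrite eqxy set22.
move: xvw yvw vxy wxy; rewrite !inE.
move=> /orP[]/eqP<- /orP[]/eqP<-; rewrite ?orbb.
- by move=> _ /eqP->.
- by [].
- by move=> *; rewrite metric_sym.
- by move=> /eqP->.
Qed.

Definition graph_length E : R := \sum_(e in E) edge_length e.

Definition is_mst E : Prop :=
  is_tree E /\ forall F, is_tree F -> graph_length E <= graph_length F.

(* The entry written with index k in the usual one-based numbering is
   nth 0 (spectrum E) k.-1. *)
Definition spectrum E : seq R := sort >=%R [seq edge_length e | e in E].

Definition star (c : X) : {set {set X}} :=
  [set [set c; x]%SET | x in [set~ c]%SET]%SET.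

Lemma star_adjacent c x y :
  adjacent (star c) x y -> (x != y) && ((x == c) || (y == c)).
Proof.
rewrite /= => /andP[-> /imsetP[z _ eqz]] /=.
have : c \in [set x; y]%SET by rewrite eqz set21.
by rewrite finset.in_set2 !(eq_sym c).
Qed.

Lemma adjacent_star c x : x != c -> adjacent (star c) c x.
Proof.
move=> xc; apply/andP; split; first by rewrite eq_sym.
by apply/imsetP; exists x; rewrite ?in_setC1.
Qed.

Lemma adjacent_sym E : symmetric (adjacent E).
Proof. by move=> x y; rewrite /adjacent /= eq_sym finset.setUC. Qed.

Lemma star_is_tree c : is_tree (star c).
Proof.
split=> [e /imsetP[x]|x y|s].
- by rewrite !inE => xc ->; rewrite cards2 eq_sym xc.
- have toc z : connect (adjacent (star c)) c z.
    by have [->|/adjacent_star/connect1] := eqVneq z c.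
  apply: connect_trans (toc y).
  by rewrite (sym_connect_sym (@adjacent_sym _)).
- case: s => [|a [|b [|d s]]] // /andP[].
  rewrite /cycle rcons_path /= -!/(adjacent _ _ _).
  move=> /andP[/andP[ab /andP[bd ds]] la] /and3P[].
  rewrite !inE !negb_or => /and3P[nab nad nas] /andP[nbd nbs] _.
  have := star_adjacent ab; have := star_adjacent bd.
  move=> /andP[_ bdc] /andP[_ abc].
  have bc : b = c.
    case/orP: abc => /eqP // ac.
    by case/orP: bdc => /eqP // dc; rewrite ac dc eqxx in nad.
  have := star_adjacent la => /andP[_ /orP[]] /eqP.
  - move=> lc; have := mem_last d s; rewrite lc -bc inE.
    by rewrite (negPf nbs) (negPf nbd).
  - by move=> ac; rewrite ac bc eqxx in nab.
Qed.

Lemma mst_exists : (0 < #|X|)%N -> exists E, is_mst E.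
Proof.
move=> /card_gt0P[c _].
have t0 : `[< is_tree (star c) >] by apply/asboolP; exact: star_is_tree.
pose E := [arg min_(E < star c | `[< is_tree E >]) graph_length E]%O.
exists E; rewrite /E; case: arg_minP => // F /asboolP tF minF.
by split=> // F' tF'; apply: minF; apply/asboolP.
Qed.

End MinimumSpanningTrees.

(* Main.v *)
(** The bound [gh <= (1 - s) / 2] holds whenever [X] can be labelled by the
    vertices of the simplex, all labels being used, so that points with
    different labels are at distance at least [s]; the bound [>=] holds whenever
    every such labelling has two differently labelled points at distance at most
    [s].  For [s] the k-th entry of the spectrum and k + 1 labels, the first
    condition is met by the components left when k longest edges of the minimum
    spanning tree are removed: a path of the tree between two components uses a
    removed edge, and exchanging that edge for the chord cannot shorten the
    tree.  The second one holds because the connected tree has at least k edges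
    between differently labelled points, while fewer than k of its edges are
    longer than [s]. *)
Require Import Defs.
From HB Require Import structures.
From mathcomp Require Import all_boot all_order all_algebra.
From mathcomp Require Import all_classical all_reals all_analysis.

Set Implicit Arguments.
Unset Strict Implicit.
Unset Printing Implicit Defensive.

Import Order.TTheory GRing.Theory Num.Theory.
From mathcomp Require Import fintype finset lra.
Import Defs.

Local Open Scope ring_scope.

(** * Walks along a relation *)

Lemma path_exit (T : eqType) (e : rel T) (P : pred T) (x : T) (p : seq T) :
    path e x p -> P x -> ~~ P (last x p) ->
  exists p1 y p2, [/\ p = p1 ++ y :: p2, P (last x p1) & ~~ P y].
Proof.
elim: p x => [|y p IHp] x /=; first by move=> _ ->.
move=> /andP[_ yp] Px nPl; have [Py|nPy] := boolP (P y).
  have [p1 [z [p2 [-> Pz nPz]]]] := IHp y yp Py nPl.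
  by exists (y :: p1), z, p2.
by exists [::], y, p.
Qed.

Lemma connect_constant (T : finType) (T' : Type) (e : rel T) (f : T -> T') x y :
  (forall u v, e u v -> f u = f v) -> connect e x y -> f x = f y.
Proof.
move=> fe /connectP[p + ->]; elim: p x => //= z p IHp x /andP[/fe-> /IHp].
exact.
Qed.

(** * Connected graphs, subtrees and edges between label classes *)

Section Graphs.
Context {R : realType}.
Variable X : finMetricType R.
Implicit Types (E F G S : {set {set X}}) (e : {set X}) (x y : X).

(** Boolean, so that a minimal connected edge set can be extracted. *)
Definition connected E := [forall x, forall y, connect (adjacent E) x y].

Lemma connectedP E :
  reflect (forall x y, connect (adjacent E) x y) (connected E).
Proof. by apply: (iffP 'forall_forallP). Qed.

Lemma adjacentE E x y : adjacent E x y = (x != y) && ([set x; y]%SET \in E).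
Proof. by []. Qed.

Lemma connect_adjacent_sym E : connect_sym (adjacent E).
Proof. exact/sym_connect_sym/adjacent_sym. Qed.

Lemma adjacentD1 E e x y :
  adjacent E x y -> [set x; y]%SET != e -> adjacent (E :\ e)%SET x y.
Proof. by rewrite !adjacentE !inE => /andP[-> ->] ->. Qed.

Lemma adjacentS E F x y : E \subset F -> adjacent E x y -> adjacent F x y.
Proof. by move=> /subsetP EF; rewrite !adjacentE => /andP[-> /EF]. Qed.

(** In a walk of [E], each use of the edge between [x] and [y] is replaced by a walk of [F]; all
    other edges lie in [F]. *)
Lemma connected_reroute E F x y :
    connected E -> connect (adjacent F) x y -> (E :\ [set x; y] \subset F)%SET ->
  connected F.
Proof.
move=> /connectedP cE xy EF; apply/connectedP => u v.
apply: connect_sub (cE u v) => {u v} u v uv.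
have [exy|nexy] := eqVneq [set u; v]%SET [set x; y]%SET; last first.
  by apply/connect1/(adjacentS EF)/adjacentD1.
have : u \in [set x; y]%SET by rewrite -exy set21.
have : v \in [set x; y]%SET by rewrite -exy set22.
move: uv; rewrite adjacentE => /andP[uv _].
rewrite !inE => /orP[]/eqP-> /orP[]/eqP-> //.
by rewrite connect_adjacent_sym.
Qed.

Lemma path_adjacentD1 E x p a b :
    a \notin x :: p -> path (adjacent E) x p ->
  path (adjacent (E :\ [set a; b])%SET) x p.
Proof.
move=> nap; apply: (@sub_in_path _ (mem (x :: p))); last exact/allP.
move=> u v up vp uv; apply: adjacentD1 uv _; apply/eqP => uvab.
have : a \in [set u; v]%SET by rewrite uvab set21.
by rewrite !inE => /orP[]/eqP aE; rewrite aE (up, vp) in nap.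
Qed.

(** A minimal connected set of edges has no cycle, since an edge of a cycle can be bypassed along
    the rest of it. *)
Lemma connected_has_subtree E :
    (forall e, e \in E -> #|e| = 2) -> connected E ->
  exists2 F : {set {set X}}, F \subset E & is_tree F.
Proof.
move=> E2 /minset_exists[F /minsetP[cF minF] FE]; exists F => //.
split=> [e eF||s]; [exact/E2/(subsetP FE)|exact/connectedP|].
case: s => [|a [|b [|d s]]] // /andP[cyc uns]; exfalso.
have ab : adjacent F a b by move: cyc; rewrite /cycle; case/andP.
have ds : path (adjacent F) b (d :: s).
  by move: cyc; rewrite /cycle rcons_path => /andP[/andP[]].
have la : adjacent F (last d s) a.
  by move: cyc; rewrite /cycle rcons_path => /andP[_].
move: (uns) => /= /and3P[na nb _].
have lb : last d s != b by apply: contraNneq nb => <-; exact: mem_last.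
suff /minF/(_ (subD1set _ _)) FD : connected (F :\ [set a; b])%SET.
  by move: ab; rewrite adjacentE -FD !inE eqxx andbF.
apply: (@connected_reroute _ _ a b) cF _ (subxx _).
(* From [b] the rest of the cycle avoids [a], hence the deleted edge; the closing edge back to [a]
   is a different one, as it does not start at [b]. *)
rewrite connect_adjacent_sym; apply: (@connect_trans _ _ (last b (d :: s))).
  by apply/connectP; exists (d :: s) => //; exact: path_adjacentD1.
apply/connect1/adjacentD1 => //=; apply: contra_neq lb => lab.
have : last d s \in [set a; b]%SET by rewrite -lab set21.
rewrite !inE => /orP[|/eqP//] /eqP la'.
by move: la; rewrite la' adjacentE eqxx.
Qed.

(** A set [A] of labels grows one label at a time: a walk out of its preimage contains an edge to a
    new label, and this edge was not yet counted within [A]. *)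
Lemma leq_card_crossing E (T : finType) (f : X -> T) :
    connected E -> (forall t, exists x, f x = t) ->
  (#|T| <= #|[set e in E | (1 < #|f @: e|)%N]%SET|.+1)%N.
Proof.
move=> /connectedP cE fsurj.
pose C (A : {set T}) :=
  [set e in E | (1 < #|f @: e|)%N & f @: e \subset A]%SET.
suff H m : (m < #|T|)%N -> exists A : {set T}, #|A| = m.+1 /\ (m <= #|C A|)%N.
  case T0 : #|T| => [//|m]; have [|A [_ mA]] := H m; first by rewrite T0.
  rewrite ltnS (leq_trans mA) // subset_leq_card //.
  by apply/subsetP => e; rewrite !inE => /and3P[-> ->].
elim: m => [/card_gt0P[t _]|m IHm mT]; first by exists [set t]; rewrite cards1.
have [A [Am mA]] := IHm (ltnW mT).
have [b] : exists b, b \in ~: A.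
  by apply/card_gt0P; rewrite cardsCs setCK subn_gt0 Am.
have [a aA] : exists a, a \in A by apply/card_gt0P; rewrite Am.
have [[x fx] [y fy]] := (fsurj a, fsurj b); rewrite inE => bA.
have /connectP[p xp yE] := cE x y.
have [||p1 [v [p2 [pE uA vA]]]] := @path_exit _ _ (fun z => f z \in A) _ _ xp.
- by rewrite fx.
- by rewrite -yE fy.
set u := last x p1 in uA.
have uv : adjacent E u v.
  by move: xp; rewrite pE cat_path => /and3P[].
exists (f v |: A); split; first by rewrite cardsU1 vA Am.
have fuv : f @: [set u; v] = [set f u; f v].
  by rewrite imsetU1 imset_set1.
have fuNv : f u != f v by apply: contraNneq vA => <-.
have uvC : [set u; v] \notin C A.
  by rewrite inE fuv subUset sub1set sub1set (negPf vA) !andbF.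
rewrite (leq_trans (n := #|[set u; v] |: C A|)) //.
  by rewrite cardsU1 uvC add1n ltnS.
apply/subset_leq_card/subsetP => e; rewrite !inE => /orP[/eqP->|].
  rewrite fuv cards2 fuNv subUset !sub1set !inE eqxx uA orbT /= andbT.
  by move: uv; rewrite adjacentE => /andP[].
by move=> /and3P[-> -> /subset_trans->] //; rewrite subsetUr.
Qed.

(** Induction on the size of [S]: deleting one more bridge splits off the component of one of its
    ends, which takes the new label. *)
Lemma exists_separating_labelling E S :
    (forall e, e \in E -> #|e| = 2) ->
    (forall x y, x != y -> [set x; y]%SET \in E ->
       ~~ connect (adjacent (E :\ [set x; y])%SET) x y) ->
    X -> S \subset E ->
  exists2 f : X -> 'I_#|S|.+1, forall i, exists x, f x = i &
    forall x y, adjacent (E :\: S)%SET x y -> f x = f y.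
Proof.
move=> E2 bridge x0; move: {2}#|S| (erefl #|S|) => m.
elim: m S => [|m IHm] S Sm SE.
  rewrite Sm; exists (fun=> ord0) => // i.
  by exists x0; rewrite ord1.
have [e eS] : exists e, e \in S by apply/card_gt0P; rewrite Sm.
have SDm : #|S :\ e| = m by apply: succn_inj; rewrite -Sm [RHS](cardsD1 e) eS.
have eE := subsetP SE _ eS.
have [f fsurj fE] := IHm _ SDm (subset_trans (subD1set _ _) SE).
rewrite SDm in f fsurj fE.
have /eqP/cards2P[x [y [xy exy]]] := E2 _ eE.
have brxy : ~~ connect (adjacent (E :\: S)) y x.
  rewrite connect_adjacent_sym.
  apply: contra (bridge _ _ xy _); last by rewrite -exy.
  apply: connect_sub => u v uv; apply/connect1/(adjacentS _ uv).
  by apply: setDS; rewrite -exy sub1set.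
rewrite Sm.
pose g z := if connect (adjacent (E :\: S)) y z then ord_max
            else widen_ord (leqnSn _) (f z).
have fED u v : adjacent (E :\: S) u v -> f u = f v.
  by move=> uv; apply: fE; apply: adjacentS uv; apply: setDS; exact: subD1set.
have fxy : f x = f y.
  by apply: fE; rewrite adjacentE xy !inE -exy eqxx.
exists g => [i|u v uv].
  have [j ->|->] := unliftP ord_max i; last by exists y; rewrite /g connect0.
  have liftE : lift ord_max j = widen_ord (leqnSn _) j.
    by apply: val_inj; rewrite /= /bump leqNgt ltn_ord.
  have [z fz] := fsurj j; have [zy|nzy] := boolP (connect (adjacent (E :\: S)) y z).
    (* If [z] is relabelled, its old label survives at [x], on the other side of the bridge. *)
    by exists x; rewrite /g (negPf brxy) fxy (connect_constant fED zy) fz.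
  by exists z; rewrite /g (negPf nzy) fz.
rewrite /g (fED _ _ uv).
by rewrite (same_connect_r (@connect_adjacent_sym _) (connect1 uv)).
Qed.

End Graphs.

(** * Exchange in minimum spanning trees, and the ordered edge lengths *)

Section MinimumSpanningTrees.
Context {R : realType}.
Variable X : finMetricType R.
Implicit Types (E F G S : {set {set X}}) (e : {set X}) (x y : X).

Lemma edge_length_gt0 e : #|e| = 2 -> 0 < edge_length e.
Proof. by move/eqP/cards2P => [x [y [xy ->]]]; rewrite edge_length2 mdist_gt0. Qed.

Lemma edge_length_ge0 e : 0 <= edge_length e.
Proof. by rewrite /edge_length; case: pickP => // p _; exact: mdist_ge0. Qed.

Lemma graph_lengthD1 E e :
  e \in E -> graph_length E = edge_length e + graph_length (E :\ e).
Proof. by move=> eE; rewrite /graph_length (big_setD1 e). Qed.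

Lemma graph_lengthU1 E e : graph_length (e |: E) <= edge_length e + graph_length E.
Proof.
have [eE|eE] := boolP (e \in E); last by rewrite /graph_length big_setU1.
have /setUidPr-> : [set e] \subset E by rewrite sub1set.
by rewrite lerDr edge_length_ge0.
Qed.

Lemma graph_lengthS E F : E \subset F -> graph_length E <= graph_length F.
Proof.
move=> EF; rewrite /graph_length [leRHS](big_setID E) /= (setIidPr EF) lerDl.
by apply: sumr_ge0 => e _; exact: edge_length_ge0.
Qed.

(** Thanks to this, exchange arguments need only preserve connectedness: passing to a subtree does
    not increase the length. *)
Lemma mst_le_connected G F :
    is_mst G -> (forall e, e \in F -> #|e| = 2) -> connected F ->
  graph_length G <= graph_length F.
Proof.
move=> [_ minG] F2 cF; have [T TF treeT] := connected_has_subtree F2 cF.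
exact: le_trans (minG _ treeT) (graph_lengthS TF).
Qed.

Lemma mst_card2 G e : is_mst G -> e \in G -> #|e| = 2.
Proof. by move=> [[+ _ _] _]; apply. Qed.

Lemma mst_connected G : is_mst G -> connected G.
Proof. by move=> [[_ + _] _] => /connectedP. Qed.

(** Otherwise deleting the edge would leave a strictly shorter connected graph. *)
Lemma mst_bridge G x y : is_mst G -> [set x; y] \in G ->
  ~~ connect (adjacent (G :\ [set x; y])) x y.
Proof.
move=> mstG xyG; apply/negP => xy.
have cG : connected (G :\ [set x; y]).
  exact: connected_reroute (mst_connected mstG) xy (subxx _).
have G2 e : e \in G :\ [set x; y] -> #|e| = 2.
  by rewrite inE => /andP[_]; exact: mst_card2.
have := mst_le_connected mstG G2 cG.
by rewrite (graph_lengthD1 xyG) gerDr leNgt edge_length_gt0 // (mst_card2 mstG).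
Qed.

(** Exchanging an edge of a simple path for the chord between the ends keeps the graph connected,
    and minimality compares the two lengths. *)
Lemma mst_path_le G x p u q :
    is_mst G -> path (adjacent G) x (p ++ u :: q) -> uniq (x :: p ++ u :: q) ->
  mdist (last x p) u <= mdist x (last u q).
Proof.
move=> mstG; set v := last x p; set y := last u q.
rewrite cat_path -/v => /and3P[xp vu uq].
rewrite -cat_cons cat_uniq => /and3P[_ dis _].
have up : u \notin x :: p.
  by apply: contra dis => up; apply/hasP; exists u => //; rewrite mem_head.
have vq : v \notin u :: q.
  apply: contra dis => vq; apply/hasP; exists v => //; exact: mem_last.
have xy : x != y.
  apply: contraNneq dis => xy; apply/hasP; exists y; first exact: mem_last.
  by rewrite -xy mem_head.
pose H := [set x; y] |: (G :\ [set v; u]).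
have GH : G :\ [set v; u] \subset H by rewrite subsetUr.
have H2 e : e \in H -> #|e| = 2.
  rewrite !inE => /orP[/eqP->|/andP[_ /(mst_card2 mstG)//]].
  by rewrite cards2 xy.
have vuH : connect (adjacent H) v u.
  have xv : connect (adjacent H) x v.
    apply/connectP; exists p => //; apply: sub_path (path_adjacentD1 v up xp).
    by move=> a b ab; apply: adjacentS ab; rewrite setUC.
  have uy : connect (adjacent H) u y.
    apply/connectP; exists q => //; apply: sub_path (path_adjacentD1 u vq uq).
    by move=> a b; exact: adjacentS.
  apply: (@connect_trans _ _ x); first by rewrite connect_adjacent_sym.
  apply: (@connect_trans _ _ y); last by rewrite connect_adjacent_sym.
  by apply: connect1; rewrite adjacentE xy !inE eqxx.
have cH : connected H := connected_reroute (mst_connected mstG) vuH GH.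
have vuG : [set v; u] \in G by move: vu => /andP[].
have := le_trans (mst_le_connected mstG H2 cH) (graph_lengthU1 _ _).
by rewrite (graph_lengthD1 vuG) lerD2r !edge_length2.
Qed.

Lemma spectrum_ge0 G i : 0 <= (spectrum G)`_i.
Proof.
have [iG|] := ltnP i (size (spectrum G)); last by move=> /(nth_default 0)->.
have : (spectrum G)`_i \in spectrum G by rewrite mem_nth.
by rewrite mem_sort => /imageP[e _ ->]; exact: edge_length_ge0.
Qed.

Lemma spectrum_nonincreasing G i j :
  (i <= j < size (spectrum G))%N -> (spectrum G)`_j <= (spectrum G)`_i.
Proof.
move=> /andP[ij jG].
have tot : total (>=%R : rel R) by move=> a b; exact: le_total.
have tr : transitive (>=%R : rel R) by move=> b a c /= ab /le_trans; apply.
apply: (sorted_leq_nth tr (@lexx _ _) 0 (sort_sorted tot _)) => //.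
by rewrite inE (leq_ltn_trans ij).
Qed.

(** Indices start at 0: only the [k] entries before index [k] can exceed the entry there. *)
Lemma card_lt_edge_length G k :
  (#|[set e in G | ((spectrum G)`_k < edge_length e)%R]| <= k)%N.
Proof.
pose s := spectrum G.
have -> : #|[set e in G | s`_k < edge_length e]| = count (> s`_k) s.
  rewrite count_sort /image_mem count_map -size_filter cardE.
  apply/perm_size/uniq_perm => [||e].
  - exact: enum_uniq.
  - exact/filter_uniq/enum_uniq.
  by rewrite mem_enum inE [RHS]mem_filter mem_enum andbC.
rewrite -[X in (count _ X <= _)%N](cat_take_drop k s) count_cat.
rewrite -[leqRHS]addn0 leq_add //.
  by rewrite (leq_trans (count_size _ _)) // size_take_min geq_minl.
rewrite leqNgt -has_count; apply/hasPn => z /(nthP 0)[i].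
rewrite size_drop nth_drop => ik <-; rewrite -leNgt.
by apply: spectrum_nonincreasing; rewrite leq_addr /= -ltn_subRL.
Qed.

Lemma exists_longest_edges G k : (k <= #|G|)%N ->
  exists S, [/\ S \subset G, #|S| = k &
    forall e, e \in S -> (spectrum G)`_k.-1 <= edge_length e].
Proof.
(* Edges, not lengths, are sorted, so that the first [k] form a set of edges. *)
move=> kG; pose s := sort (relpre (@edge_length R X) >=%R) (enum G).
have sG : spectrum G = map (@edge_length R X) s by rewrite /spectrum /image_mem sort_map.
have ss : size s = #|G| by rewrite size_sort cardE.
have us : uniq s by rewrite sort_uniq enum_uniq.
exists [set e in take k s]; split.
- by apply/subsetP => e; rewrite inE => /mem_take; rewrite mem_sort mem_enum.
- by rewrite cardsE (card_uniqP (take_uniq _ us)) size_take_min ss (minn_idPl kG).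
move=> e; rewrite inE => /(nthP set0)[i]; rewrite size_take_min ss (minn_idPl kG).
move=> ik <-; rewrite nth_take // -(nth_map set0 0) ?ss ?(leq_trans ik) // -sG.
have k0 : (0 < k)%N by apply: leq_trans ik.
apply: spectrum_nonincreasing; rewrite sG size_map ss prednK // kG andbT.
by rewrite -ltnS prednK.
Qed.

Lemma exists_spectrum_labelling G k : is_mst G -> (0 < k <= #|X| - 1)%N ->
  exists2 f : X -> 'I_k.+1, forall i, exists x, f x = i &
    forall x y, f x != f y -> (spectrum G)`_k.-1 <= mdist x y.
Proof.
move=> mstG /andP[k0 kX].
have kG : (k <= #|G|)%N.
  apply: leq_trans kX _; rewrite leq_subLR add1n.
  (* With all points labelled differently, the crossing count bounds the number of edges from
     below. *)
  have idsurj (x : X) : exists x', id x' = x by exists x.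
  apply: leq_trans (leq_card_crossing (mst_connected mstG) idsurj) _.
  by rewrite ltnS subset_leq_card //; apply/subsetP => e; rewrite inE => /andP[].
have [x0 _] : exists x : X, x \in X.
  exact/card_gt0P/(leq_trans (leq_trans k0 kX))/leq_subr.
have [S [SG Sk Sge]] := exists_longest_edges kG.
have G2 e : e \in G -> #|e| = 2 by exact: mst_card2.
have [|f fsurj fE] := exists_separating_labelling G2 _ x0 SG.
  by move=> x y _; exact: mst_bridge.
rewrite Sk in f fsurj fE; exists f => // x y fxy.
have /connectP[p0 p0P yE] := (connectedP _ (mst_connected mstG)) x y.
case: (shortenP p0P) yE => p xp uxp _ yE.
(* An edge of the simple path leaves the label class of [x]; it lies in [S], as the other edges of
   [G] preserve labels. *)
have [||p1 [u [p2 [pE /eqP fp1 fu]]]] := @path_exit _ _ (fun z => f z == f x) _ _ xp.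
- by rewrite eqxx.
- by rewrite -yE eq_sym.
rewrite pE in xp uxp yE; rewrite yE last_cat /=.
apply: le_trans (mst_path_le mstG xp uxp).
move: xp; rewrite cat_path => /and3P[_ vu _].
rewrite -edge_length2; apply: Sge; apply: contraNT fu => nS.
rewrite -fp1; apply/eqP/esym/fE.
by move: vu; rewrite !adjacentE inE nS => /andP[-> ->].
Qed.

Lemma spectrum_labelling_le G k (f : X -> 'I_k.+1) :
    is_mst G -> (0 < k)%N -> (forall i, exists x, f x = i) ->
  exists x y, f x != f y /\ mdist x y <= (spectrum G)`_k.-1.
Proof.
move=> mstG k0 fsurj.
have : (k <= #|[set e in G | (1 < #|f @: e|)%N]|)%N.
  by have := leq_card_crossing (mst_connected mstG) fsurj; rewrite card_ord.
set C := [set e in G | _] => kC.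
have [e] : exists e, e \in C :\: [set e in G | ((spectrum G)`_k.-1 < edge_length e)%R].
  apply/card_gt0P; rewrite cardsD subn_gt0.
  apply: leq_ltn_trans (subset_leq_card (subsetIr _ _)) _.
  apply: leq_ltn_trans (card_lt_edge_length _ _) _.
  by rewrite prednK.
rewrite !inE => /andP[+ /andP[eG]]; rewrite eG /= -leNgt.
have /eqP/cards2P[x [y [_ ->]]] := mst_card2 mstG eG.
rewrite imsetU1 imset_set1 edge_length2 cards2 => xys fxy.
by exists x, y; split=> //; case: eqP fxy.
Qed.

End MinimumSpanningTrees.

(** * Gromov-Hausdorff distance to a simplex *)

Section GromovHausdorffSimplex.
Context {R : realType}.

(* With r = (1 - s) / 2, the larger value (1 + s) / 2 is r + s: the least one
   compatible with 1 <= d(i, x) + d(x, j), and at most r + d(x, y) for y with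
   label i. *)
Definition glued_dist (X : metricType R) (m : nat) (f : X -> 'I_m) (s : R)
    (u v : X + 'I_m) : R :=
  match u, v with
  | inl x, inl y => mdist x y
  | inr i, inr j => (i != j)%:R
  | inl x, inr i | inr i, inl x => if f x == i then (1 - s) / 2 else (1 + s) / 2
  end.

Lemma gromov_hausdorff_simplex_le (X : metricType R) (m : nat) (f : X -> 'I_m)
    (s : R) :
    0 <= s <= 1 / 2 -> (forall x y : X, mdist x y <= 1 / 2) ->
    (forall i, exists x, f x = i) ->
    (forall x y, f x != f y -> s <= mdist x y) ->
  (gromov_hausdorff_dist X (simplex R m) <= ((1 - s) / 2)%:E)%E.
Proof.
move=> /andP[s0 s1] Xdiam fsurj fsep; pose d := glued_dist f s.
have dxx u : d u u = 0 by case: u => [x|i]; rewrite /d /= ?mdistxx ?eqxx.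
have dpos u v : d u v = 0 -> u = v.
  case: u v => [x|i] [y|j]; rewrite /d /=.
  - by move=> /mdist_positivity->.
  - by case: ifP => _ h; exfalso; lra.
  - by case: ifP => _ h; exfalso; lra.
  - by case: eqVneq => [->//|_ /eqP]; rewrite oner_eq0.
have dsym u v : d u v = d v u.
  by case: u v => [x|i] [y|j]; rewrite /d //= ?(metric_sym x) // eq_sym.
have dtri v u w : d u w <= d u v + d v w.
  case: u v w => [x|i] [y|j] [z|l]; rewrite /d /=.
  - exact: metric_triangle.
  (* The separation [s] is needed when [y] has label [l] and [x] does not. *)
  - have := mdist_ge0 x y; have := @fsep x y.
    case: (eqVneq (f y) l) => [->|_]; case: (eqVneq (f x) l) => //= _; lra.
  (* The detour through [j] has length at least [1 - s], hence at least [1 / 2]: the diameter bound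
     enters here. *)
  - have := Xdiam x z.
    by case: (f x == j) => /=; case: (f z == j); lra.
  - case: (eqVneq j l) => [->|jl]; first by rewrite addr0.
    by case: (f _ == _); case: (f _ == _) => /=; lra.
  - have := mdist_ge0 y z; have := @fsep y z.
    rewrite (eq_sym (f y)); case: (eqVneq (f y) i) => [->|_];
      case: (eqVneq (f z) i) => //= _; lra.
  (* For distinct [i] and [l], at most one is the label of [y], so the sum is at least [1]. *)
  - case: (eqVneq (f y) i) => [->|yi]; first by case: (i == l) => /=; lra.
    case: (eqVneq (f y) l) => [<-|_]; first by rewrite eq_sym yi /=; lra.
    by case: (i != l) => /=; lra.
  - case: (eqVneq i j) => [->|ij]; first by rewrite add0r.
    by case: (f _ == _); case: (f _ == _) => /=; lra.
  - exact: simplex_dist_triangle.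
pose Z : metricType R := HB.pack (X + 'I_m)%type
  (isMetric.Build R (X + 'I_m)%type dxx dpos dsym dtri).
apply: ge_ereal_inf; exists ((1 - s) / 2)%:E => //.
exists ((1 - s) / 2) => //.
exists Z, (range (inl : X -> Z)), (range (inr : 'I_m -> Z)).
split; [by exists (inl : X -> Z)|by exists (inr : simplex R m -> Z)|].
(* Balls are open, so the radius is enlarged by an arbitrary positive [e]. *)
apply/lee_addgt0Pr => e e0; rewrite -EFinD.
apply: ge_ereal_inf; exists ((1 - s) / 2 + e)%:E => //.
exists ((1 - s) / 2 + e) => //; split; first lra.
- move=> _ [x _ <-]; exists (inr (f x)); first by exists (f x).
  by rewrite ballEmdist /= /mdist /= /d /= eqxx ltrDl.
- move=> _ [i _ <-]; have [x <-] := fsurj i; exists (inl x); first by exists x.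
  by rewrite ballEmdist /= /mdist /= /d /= eqxx ltrDl.
Qed.

(** A smaller distance would let nearby simplex vertices label [X], with differently labelled points
    more than [s] apart. *)
Lemma gromov_hausdorff_simplex_ge (X : metricType R) (m : nat) (s : R) :
    0 <= s ->
    (forall f : X -> 'I_m, (forall i, exists x, f x = i) ->
       exists x y, f x != f y /\ mdist x y <= s) ->
  (((1 - s) / 2)%:E <= gromov_hausdorff_dist X (simplex R m))%E.
Proof.
move=> s0 Hf; apply: le_ereal_inf_tmp => _ [r [Z [X' [Y' [XX' YY' rH]]]] <-].
rewrite leNgt; apply/negP => rs.
have /ereal_inf_lt[_ [t [t0 X'Y' Y'X'] <-]] := le_lt_trans rH rs.
rewrite lte_fin => ts.
have [g gmdist gX'] := XX'; have [h hmdist hY'] := YY'.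
have hE i j : mdist (h i) (h j) = (i != j)%:R by rewrite hmdist.
have near_label x : exists i, mdist (g x) (h i) < t.
  have : X' (g x) by rewrite -gX'; exists x.
  move=> /X'Y'[z + +]; rewrite -hY' => -[i _ <-].
  by rewrite ballEmdist /= metric_sym; exists i.
have [f fP] := boolp.choice near_label.
(* Two such vertices are less than [2 * t < 1] apart, as [s] is nonnegative. *)
have near_uniq x i j : mdist (g x) (h i) < t -> mdist (g x) (h j) < t -> i = j.
  move=> xi xj; apply/eqP; apply: contraTT isT => ij.
  have := metric_triangle (h i) (g x) (h j).
  by rewrite hE ij (metric_sym (h i)) /=; lra.
have [|x [y [fxy xys]]] := Hf f.
  move=> i; have : Y' (h i) by rewrite -hY'; exists i.
  move=> /Y'X'[z + +]; rewrite -gX' => -[x _ <-].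
  by rewrite ballEmdist /= => xi; exists x; apply: near_uniq xi.
(* The two inequalities give [1 < 2 * t + s], against [t < (1 - s) / 2]. *)
have := metric_triangle (h (f x)) (g x) (h (f y)).
have := metric_triangle (g x) (g y) (h (f y)).
have := fP x; have := fP y.
by rewrite hE fxy (metric_sym (h (f x))) gmdist /=; lra.
Qed.

End GromovHausdorffSimplex.

Theorem theorem3p1 (R : realType) (X : finMetricType R) (G : {set {set X}})
    (mstG : is_mst G) (diamX : (diam X <= (1 / 2)%:E)%E) (k : nat)
    (hk : (1 <= k <= #|X| - 1)%N) :
  ((spectrum G)`_k.-1)%:E =
    (1 - 2%:E * gromov_hausdorff_dist X (simplex R k.+1))%E.
Proof.
set s := (spectrum G)`_k.-1; have /andP[k0 _] := hk.
have Xdiam (x y : X) : mdist x y <= 1 / 2.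
  rewrite -lee_fin; apply: le_trans diamX.
  by apply: ereal_sup_ubound; exists (x, y).
have s0 : 0 <= s := spectrum_ge0 G k.-1.
have [f fsurj fsep] := exists_spectrum_labelling mstG hk.
(* As [k] is positive, two labels differ, and points carrying them are at least [s] apart. *)
have s1 : s <= 1 / 2.
  have [[x fx] [y fy]] := (fsurj ord0, fsurj ord_max).
  apply: le_trans (Xdiam x y); apply: fsep.
  by rewrite fx fy -val_eqE /= eq_sym -lt0n.
have -> : gromov_hausdorff_dist X (simplex R k.+1) = ((1 - s) / 2)%:E.
  apply/le_anti/andP; split.
    by apply: gromov_hausdorff_simplex_le fsurj fsep; rewrite ?s0.
  apply: gromov_hausdorff_simplex_ge => // g gsurj.
  exact: spectrum_labelling_le.
by rewrite -EFinM -EFinB; congr EFin; lra.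
Qed.
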